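(* Let $n$ be an even positive integer. Then $$G = -T\left(\frac14\right) = \frac{2n+1}{n}\sum_{j=1}^n (-1)^{j+1}\, T\left(\frac{2j-1}{8n+4}\right).$$
   Context: Catalan's constant is $G := \sum_{k=0}^\infty \frac{(-1)^k}{(2k+1)^2}$. For real $r$ with $0\le r\le \tfrac12$, $T(r) := \int_0^{r\pi}\log(\tan\theta)\,d\theta$ (the integrand has integrable logarithmic singularities at $0$ and $\pi/2$). *)

(* Defs.v *)
From Stdlib Require Import Reals.
From Coquelicot Require Import Coquelicot.
Open Scope R_scope.

Definition Catalan : R :=
  Series (fun k : nat => (-1) ^ k / (2 * INR k + 1) ^ 2).

(** Improper Riemann integral of [ln (tan t)] from 0 to [r * PI], meaningful
    for [0 <= r <= 1/2].  Both bounds approach their limits from inside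
    ]0, PI/2[, so that the singularities at 0 and at PI/2 (the latter when
    [r = 1/2]) are never touched; at [r = 0] both bounds tend to 0 and the
    value is 0. *)
Definition T (r : R) : R :=
  RInt_gen (fun t : R => ln (tan t))
    (at_right 0)
    (within (fun x : R => 0 < x < PI / 2) (locally (r * PI))).

(* Main.v *)
Require Import Defs.
From Stdlib Require Import Reals.
From Coquelicot Require Import Coquelicot.
From Stdlib Require Import Lra Lia.
Open Scope R_scope.

(** Integration by parts gives a primitive of [ln (tan x)] on the open quadrant,
    [Lam x = x * ln (tan x) - Ti2 (tan x)], where [Ti2] is the inverse tangent
    integral; it tends to 0 at 0, so [T r = Lam (r * PI)] for [0 < r < 1 / 2]
    ([T_eq_Lam]).  As [Ti2 1] is the sum of the series obtained by integrating
    that of [atan v / v], namely Catalan's constant, [T (1 / 4) = - Catalan].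

    For the finite sum put [N = 2 n + 1] and [a_k = k PI / N].  The
    multiple-angle formula
    [tan (N x) = tan x * prod_(1 <= k <= n) tan (a_k + x) * tan (a_k - x)]
    follows from the factorization of the polynomial expressing
    [sin (N x) / sin x] in [sin x ^ 2], whose [n] roots are the
    [sin a_k ^ 2].  Taking logarithms and integrating from 0
    ([Lam_odd_mult]) gives
    [Lam (N x) / N = Lam x + sum_(1 <= k <= n) (Lam (a_k + x) - Lam (a_k - x))],
    where all angles stay inside the quadrant when [0 < x < PI / (2 N)], so
    that no singularity is crossed.

    At [x = PI / (4 N)] the right-hand side is the alternating sum of the
    [Lam ((2 j - 1) PI / (4 N))] for [1 <= j <= N].  The symmetry
    [Lam (PI / 2 - x) = Lam x] folds it around its middle term, [j = n + 1],
    which is [Lam (PI / 4)] with sign [+] because [n] is even.  Hence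
    [Lam (PI / 4) / N = Lam (PI / 4) + 2 S] with [S] the sum of the theorem,
    and solving for [S] finishes the proof. *)

(** * Functions with vanishing or comparable derivatives *)

Lemma derive_zero_const (h : R -> R) (a b : R) :
  (forall x, a < x < b -> is_derive h x 0) ->
  forall x y, a < x < b -> a < y < b -> h x = h y.
Proof.
intros Hh.
assert (H : forall x y, a < x -> x < y -> y < b -> h x = h y).
{ intros x y Hx Hxy Hy.
  destruct (MVT_cor2 h (fun _ => 0) x y Hxy) as [c [Hc _]].
  - intros c Hc. apply is_derive_Reals, Hh. lra.
  - lra. }
intros x y Hx Hy.
destruct (Rtotal_order x y) as [Hlt | [-> | Hgt]].
- apply H; lra.
- reflexivity.
- symmetry. apply H; lra.
Qed.

Lemma derive_zero_right_lim_0 (h : R -> R) (b : R) :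
  (forall x, 0 < x < b -> is_derive h x 0) ->
  filterlim h (at_right 0) (locally 0) ->
  forall x, 0 < x < b -> h x = 0.
Proof.
intros Hh Hlim x Hx.
apply (filterlim_locally_unique (V := R_NormedModule) (F := at_right 0) h); [ | exact Hlim].
apply (filterlim_ext_loc (fun _ => h x)); [ | apply filterlim_const].
assert (Hb : 0 < b) by lra.
exists (mkposreal b Hb). intros y Hy Hy0.
apply Rabs_def2 in Hy. unfold minus, plus, opp in Hy. simpl in Hy.
apply (derive_zero_const h 0 b Hh); lra.
Qed.

Lemma Rabs_le_of_Rabs_derive_le (f g df dg : R -> R) :
  f 0 = 0 -> g 0 = 0 ->
  (forall x, 0 <= x <= 1 -> is_derive f x (df x)) ->
  (forall x, 0 <= x <= 1 -> is_derive g x (dg x)) ->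
  (forall x, 0 < x < 1 -> Rabs (df x) <= dg x) ->
  forall x, 0 <= x <= 1 -> Rabs (f x) <= g x.
Proof.
intros f0 g0 Df Dg Hle x Hx.
destruct (Req_dec x 0) as [-> | Hx0].
{ rewrite f0, g0, Rabs_R0. lra. }
assert (Hx' : 0 < x) by lra.
destruct (MVT_cor2 (fun t => g t - f t) (fun t => dg t - df t) 0 x Hx') as [c [Ec Hc]].
{ intros c Hc. apply is_derive_Reals.
  apply (is_derive_minus (K := R_AbsRing) (V := R_NormedModule)); [apply Dg | apply Df]; lra. }
destruct (MVT_cor2 (fun t => g t + f t) (fun t => dg t + df t) 0 x Hx') as [d [Ed Hd]].
{ intros d Hd. apply is_derive_Reals.
  apply (is_derive_plus (K := R_AbsRing) (V := R_NormedModule)); [apply Dg | apply Df]; lra. }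
assert (Bc := Hle c ltac:(lra)). assert (Bd := Hle d ltac:(lra)).
apply Rabs_le_between in Bc. apply Rabs_le_between in Bd.
apply Rabs_le. nra.
Qed.

(** * The inverse tangent integral and Catalan's constant *)

(** The value 1 at the removable singularity makes this continuous on the
    whole line, so that its integrals from 0 are proper. *)
Definition atan_quotient (v : R) : R :=
  if Req_EM_T v 0 then 1 else atan v / v.

(** The inverse tangent integral. *)
Definition Ti2 (u : R) : R := RInt atan_quotient 0 u.

Lemma atan_quotient_neq0 (v : R) : v <> 0 -> atan_quotient v = atan v / v.
Proof.
intros Hv. unfold atan_quotient. destruct (Req_EM_T v 0); [contradiction | reflexivity].
Qed.

Lemma continuous_atan_quotient (v : R) : continuous atan_quotient v.
Proof.
destruct (Req_dec v 0) as [-> | Hv].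
- apply continuity_pt_filterlim.
  assert (D := is_derive_atan 0). apply is_derive_Reals in D.
  intros eps Heps. destruct (D eps Heps) as [del Hdel].
  exists del. split; [apply del | ].
  intros x [[_ Hx0] Hx]. simpl in *. unfold Rdist in *.
  rewrite atan_quotient_neq0 by auto.
  unfold atan_quotient. destruct (Req_EM_T 0 0); [ | lra].
  assert (H := Hdel x ltac:(auto) ltac:(rewrite Rminus_0_r in Hx; exact Hx)).
  rewrite Rplus_0_l, atan_0, Rsqr_0 in H.
  replace (atan x / x - 1) with ((atan x - 0) / x - / (1 + 0)); [exact H | field; auto].
- apply (continuous_ext_loc _ (fun w => atan w / w)).
  + assert (Hp : 0 < Rabs v) by (apply Rabs_pos_lt; auto).
    exists (mkposreal _ Hp). intros y Hy. symmetry. apply atan_quotient_neq0.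
    intros ->. unfold ball in Hy. simpl in Hy. unfold AbsRing_ball, abs, minus, plus, opp in Hy.
    simpl in Hy. rewrite Rplus_0_l, Rabs_Ropp in Hy. lra.
  + apply (ex_derive_continuous (fun w => atan w / w)).
    apply (ex_derive_div atan (fun w => w)); [ | apply ex_derive_id | exact Hv].
    eexists. apply is_derive_atan.
Qed.

Lemma is_derive_Ti2 (u : R) : is_derive Ti2 u (atan_quotient u).
Proof.
apply (is_derive_RInt atan_quotient Ti2 0 u).
- apply filter_forall. intros w.
  apply (RInt_correct (V := R_CompleteNormedModule)), (ex_RInt_continuous (V := R_CompleteNormedModule)).
  intros z _. apply continuous_atan_quotient.
- apply continuous_atan_quotient.
Qed.

Lemma Ti2_0 : Ti2 0 = 0.
Proof. apply (RInt_point (V := R_CompleteNormedModule)). Qed.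

Lemma sum_geom_neg_sqr (K : nat) (v : R) :
  sum_n (fun k => (-1) ^ k * v ^ (2 * k)) K =
  (1 + (-1) ^ K * v ^ (2 * K + 2)) / (1 + v ^ 2).
Proof.
assert (1 + v ^ 2 <> 0) by nra.
induction K as [ | K IH].
- rewrite sum_O. simpl. field. simpl in H. lra.
- rewrite sum_Sn, IH.
  match goal with |- plus ?x ?y = ?b => change (x + y = b :> R) end.
  replace (2 * S K + 2)%nat with (2 * K + 2 + 2)%nat by lia.
  replace (2 * S K)%nat with (2 * K + 2)%nat by lia.
  rewrite (pow_add v (2 * K + 2) 2), <- (tech_pow_Rmult (-1) K). field. auto.
Qed.

(** The derivative of the remainder is, up to sign, the remainder
    [v ^ (2 K + 2) / (1 + v ^ 2)] of a geometric sum. *)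
Lemma atan_taylor_bound (K : nat) (v : R) : 0 <= v <= 1 ->
  Rabs (atan v - sum_n (fun k => (-1) ^ k * v ^ (2 * k + 1) / (2 * INR k + 1)) K)
    <= v ^ (2 * K + 3) / (2 * INR K + 3).
Proof.
revert v.
assert (HK : 0 <= INR K) by apply pos_INR.
apply Rabs_le_of_Rabs_derive_le
  with (df := fun v => / (1 + v²) - sum_n (fun k => (-1) ^ k * v ^ (2 * k)) K)
       (dg := fun v => v ^ (2 * K + 2)).
- rewrite atan_0, (sum_n_ext _ (fun _ => 0)).
  + rewrite sum_n_const. ring.
  + intros k. rewrite pow_ne_zero, Rmult_0_r by lia. apply Rdiv_0_l.
- rewrite pow_ne_zero by lia. unfold Rdiv. ring.
- intros x _.
  apply (is_derive_minus (K := R_AbsRing) (V := R_NormedModule)); [apply is_derive_atan | ].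
  apply (is_derive_sum_n (K := R_AbsRing) (V := R_NormedModule)
    (fun k v => (-1) ^ k * v ^ (2 * k + 1) / (2 * INR k + 1))).
  intros k _. assert (Hk : 0 <= INR k) by apply pos_INR.
  auto_derive; auto.
  replace (k + (k + 0) + 1)%nat with (S (2 * k)) by lia.
  rewrite Nat.pred_succ, S_INR, mult_INR. change (INR 2) with 2. field. lra.
- intros x _. auto_derive; auto.
  replace (K + (K + 0) + 3)%nat with (S (2 * K + 2)) by lia.
  rewrite Nat.pred_succ, S_INR, plus_INR, mult_INR. change (INR 2) with 2. field. lra.
- intros x Hx. rewrite sum_geom_neg_sqr. unfold Rsqr.
  assert (Hp : 0 <= x ^ (2 * K + 2)) by (apply pow_le; lra).
  replace (/ (1 + x * x) - (1 + (-1) ^ K * x ^ (2 * K + 2)) / (1 + x ^ 2))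
    with (- (-1) ^ K * (x ^ (2 * K + 2) / (1 + x ^ 2))) by (field; nra).
  rewrite Rabs_mult, Rabs_Ropp, pow_1_abs, Rmult_1_l, Rabs_pos_eq.
  + apply Rle_div_l; nra.
  + apply Rdiv_le_0_compat; nra.
Qed.

(** Integrating [atan_taylor_bound] divided by [v] term by term. *)
Lemma Ti2_taylor_bound (K : nat) (u : R) : 0 <= u <= 1 ->
  Rabs (Ti2 u - sum_n (fun k => (-1) ^ k * u ^ (2 * k + 1) / (2 * INR k + 1) ^ 2) K)
    <= u ^ (2 * K + 3) / (2 * INR K + 3) ^ 2.
Proof.
revert u.
assert (HK : 0 <= INR K) by apply pos_INR.
apply Rabs_le_of_Rabs_derive_le
  with (df := fun u => atan_quotient u -
          sum_n (fun k => (-1) ^ k * u ^ (2 * k) / (2 * INR k + 1)) K)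
       (dg := fun u => u ^ (2 * K + 2) / (2 * INR K + 3)).
- rewrite Ti2_0, (sum_n_ext _ (fun _ => 0)).
  + rewrite sum_n_const. ring.
  + intros k. rewrite pow_ne_zero, Rmult_0_r by lia. apply Rdiv_0_l.
- rewrite pow_ne_zero by lia. unfold Rdiv. ring.
- intros x _.
  apply (is_derive_minus (K := R_AbsRing) (V := R_NormedModule)); [apply is_derive_Ti2 | ].
  apply (is_derive_sum_n (K := R_AbsRing) (V := R_NormedModule)
    (fun k u => (-1) ^ k * u ^ (2 * k + 1) / (2 * INR k + 1) ^ 2)).
  intros k _. assert (Hk : 0 <= INR k) by apply pos_INR.
  auto_derive; auto.
  replace (k + (k + 0) + 1)%nat with (S (2 * k)) by lia.
  rewrite Nat.pred_succ, S_INR, mult_INR. change (INR 2) with 2. field. lra.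
- intros x _. auto_derive; auto.
  replace (K + (K + 0) + 3)%nat with (S (2 * K + 2)) by lia.
  rewrite Nat.pred_succ, S_INR, plus_INR, mult_INR. change (INR 2) with 2. field. lra.
- intros x Hx. rewrite atan_quotient_neq0 by lra.
  assert (B := atan_taylor_bound K x ltac:(lra)).
  apply (Rmult_le_reg_r x); [lra | ].
  rewrite <- (Rabs_pos_eq x) at 3 by lra. rewrite <- Rabs_mult.
  replace (x ^ (2 * K + 2) / (2 * INR K + 3) * x) with (x ^ (2 * K + 3) / (2 * INR K + 3)).
  + eapply Rle_trans; [ | exact B]. right. f_equal.
    rewrite Rmult_minus_distr_r. f_equal; [field; lra | ].
    transitivity (sum_n (fun k => (-1) ^ k * x ^ (2 * k) / (2 * INR k + 1) * x) K).
    * symmetry. apply (sum_n_mult_r (K := R_Ring) x).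
    * apply sum_n_ext. intros k. rewrite pow_add, pow_1.
      unfold Rdiv. rewrite <- !Rmult_assoc. rewrite !Rmult_assoc. do 2 f_equal. apply Rmult_comm.
  + replace (2 * K + 3)%nat with (2 * K + 2 + 1)%nat by lia.
    rewrite (pow_add x (2 * K + 2) 1), pow_1. field. lra.
Qed.

Lemma Catalan_eq_Ti2_1 : Catalan = Ti2 1.
Proof.
unfold Catalan. apply is_series_unique.
apply (is_lim_seq_ext (fun K => Ti2 1 -
  (Ti2 1 - sum_n (fun k => (-1) ^ k * 1 ^ (2 * k + 1) / (2 * INR k + 1) ^ 2) K))
  _ (Ti2 1)).
{ intros K. transitivity
    (sum_n (fun k => (-1) ^ k * 1 ^ (2 * k + 1) / (2 * INR k + 1) ^ 2) K); [ring | ].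
  apply sum_n_ext. intros k. rewrite pow1, Rmult_1_r. reflexivity. }
replace (Finite (Ti2 1)) with (Finite (Ti2 1 - 0)) by (f_equal; ring).
apply is_lim_seq_minus'; [apply is_lim_seq_const | ].
apply is_lim_seq_abs_0.
apply (is_lim_seq_le_le (fun _ => 0) _ (fun K => / (INR (S K)))).
- intros K. split; [apply Rabs_pos | ].
  eapply Rle_trans; [apply Ti2_taylor_bound; lra | ].
  rewrite pow1, S_INR. assert (HK : 0 <= INR K) by apply pos_INR.
  unfold Rdiv. rewrite Rmult_1_l. apply Rinv_le_contravar; nra.
- apply is_lim_seq_const.
- apply (is_lim_seq_incr_1 (fun K => / INR K)).
  replace (Finite 0) with (Rbar_inv p_infty) by reflexivity.
  apply is_lim_seq_inv; [apply is_lim_seq_INR | discriminate].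
Qed.

(** * A primitive of the logarithm of the tangent *)

(** Obtained by integrating by parts and substituting [u = tan t] in the
    remaining integral of [t / (sin t * cos t)]. *)
Definition Lam (x : R) : R := x * ln (tan x) - Ti2 (tan x).

Lemma is_derive_Lam (x : R) : 0 < x < PI / 2 -> is_derive Lam x (ln (tan x)).
Proof.
intros Hx. assert (Hc : cos x <> 0) by (apply Rgt_not_eq, cos_gt_0; lra).
assert (Ht : 0 < tan x) by (apply tan_gt_0; lra).
assert (Dt := is_derive_tan x Hc).
replace (ln (tan x)) with
  ((1 * ln (tan x) + x * ((tan x ^ 2 + 1) * / tan x))
    - (tan x ^ 2 + 1) * atan_quotient (tan x)).
- apply (is_derive_minus (K := R_AbsRing) (V := R_NormedModule)).
  + apply (is_derive_mult (K := R_AbsRing) (fun x => x) (fun x => ln (tan x))).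
    * apply (is_derive_id (K := R_AbsRing)).
    * apply (is_derive_comp ln tan); [apply is_derive_ln, Ht | exact Dt].
    * intros; apply Rmult_comm.
  + apply (is_derive_comp Ti2 tan); [apply is_derive_Ti2 | exact Dt].
- rewrite atan_quotient_neq0, atan_tan by lra. field. lra.
Qed.

Lemma continuous_Lam (x : R) : 0 < x < PI / 2 -> continuous Lam x.
Proof.
intros Hx. apply (ex_derive_continuous Lam). eexists. apply is_derive_Lam, Hx.
Qed.

Lemma Lam_PI4 : Lam (PI / 4) = - Catalan.
Proof. unfold Lam. rewrite tan_PI4, ln_1, Catalan_eq_Ti2_1. ring. Qed.

Lemma filterlim_Rminus {S : Type} (F : (S -> Prop) -> Prop) {FF : Filter F}
    (f g : S -> R) (lf lg : R) :
  filterlim f F (locally lf) -> filterlim g F (locally lg) ->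
  filterlim (fun x => f x - g x) F (locally (lf - lg)).
Proof.
intros Hf Hg. apply (filterlim_comp_2 (G := locally lf) (H := locally (- lg))
  f (fun x => - g x) Rplus).
- exact Hf.
- apply (filterlim_comp _ _ _ g Ropp F (locally lg)); [exact Hg | ].
  apply (filterlim_opp (V := R_NormedModule)).
- apply (filterlim_plus (V := R_NormedModule)).
Qed.

Lemma x_le_tan (x : R) : 0 < x < PI / 2 -> x <= tan x.
Proof.
intros Hx.
destruct (MVT_cor2 tan (fun c => tan c ^ 2 + 1) 0 x) as [c [Hc _]]; [lra | | ].
- intros c Hc. apply is_derive_Reals, is_derive_tan, Rgt_not_eq, cos_gt_0; lra.
- rewrite tan_0 in Hc. nra.
Qed.

(** This is [ln y <= y] at [y = / sqrt t]; the square root leaves a bound that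
    still tends to 0 at 0 after multiplication by [t]. *)
Lemma ln_lower_bound (t : R) : 0 < t -> - 2 / sqrt t <= ln t.
Proof.
intros Ht. assert (Hs : 0 < sqrt t) by (apply sqrt_lt_R0, Ht).
rewrite <- (sqrt_sqrt t) at 2 by lra. rewrite ln_mult by auto.
assert (H := exp_ineq1_le (ln (/ sqrt t))).
rewrite exp_ln, ln_Rinv in H by auto using Rinv_0_lt_compat.
unfold Rdiv. lra.
Qed.

(** The factor [x], at most [tan x], beats the logarithm of [tan x]. *)
Lemma filterlim_Lam_0 : filterlim Lam (at_right 0) (locally 0).
Proof.
assert (HPI := PI_RGT_0).
assert (Ct : continuous tan 0).
{ apply (ex_derive_continuous tan). eexists. apply is_derive_tan.
  rewrite cos_0. lra. }
replace (locally 0) with (locally (0 - Ti2 (tan 0)))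
  by (rewrite tan_0, Ti2_0; f_equal; ring).
apply (filterlim_Rminus (at_right 0)).
- change (locally 0) with (Rbar_locally (Finite 0)).
  apply (filterlim_le_le (fun x => - 2 * sqrt (tan x)) _ (fun _ => 0) 0).
  + assert (H4 : 0 < PI / 4) by lra.
    exists (mkposreal _ H4). intros x Hx Hx0.
    apply Rabs_def2 in Hx. unfold minus, plus, opp in Hx. simpl in Hx.
    assert (Hx' : 0 < x < PI / 4) by lra.
    assert (Ht := x_le_tan x ltac:(lra)).
    assert (Ht1 : tan x < 1)
      by (rewrite <- tan_PI4; apply tan_increasing; lra).
    assert (Hl := ln_lower_bound (tan x) ltac:(lra)).
    assert (Hs : 0 < sqrt (tan x)) by (apply sqrt_lt_R0; lra).
    assert (Hl0 : ln (tan x) < 0) by (rewrite <- ln_1; apply ln_increasing; lra).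
    split; [ | nra].
    apply Rle_trans with (tan x * ln (tan x)); [ | nra].
    replace (- 2 * sqrt (tan x)) with (tan x * (- 2 / sqrt (tan x))).
    * apply Rmult_le_compat_l; lra.
    * rewrite <- (sqrt_sqrt (tan x)) at 1 by lra. field. lra.
  + change (Rbar_locally 0) with (locally 0).
    replace (locally 0) with (locally (- 2 * sqrt (tan 0)))
      by (rewrite tan_0, sqrt_0; f_equal; ring).
    eapply filterlim_filter_le_1; [apply filter_le_within | ].
    apply (continuous_scal_r (K := R_AbsRing) (V := R_NormedModule) (- 2)
      (fun x => sqrt (tan x))).
    apply continuous_sqrt_comp, Ct.
  + apply filterlim_const.
- eapply filterlim_filter_le_1; [apply filter_le_within | ].
  apply (continuous_comp tan Ti2); [exact Ct | ].
  apply (ex_derive_continuous Ti2). eexists. apply is_derive_Ti2.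
Qed.

(** Complementary angles have tangents with product 1, so the two sides have
    the same derivative; they agree at the fixed point [PI / 4]. *)
Lemma Lam_reflect (x : R) : 0 < x < PI / 2 -> Lam (PI / 2 - x) = Lam x.
Proof.
intros Hx. assert (HPI := PI_RGT_0).
enough (H : Lam (PI / 2 - x) - Lam x = Lam (PI / 2 - PI / 4) - Lam (PI / 4)).
{ replace (PI / 2 - PI / 4) with (PI / 4) in H by field. lra. }
apply (derive_zero_const (fun x => Lam (PI / 2 - x) - Lam x) 0 (PI / 2)); [ | lra | lra].
clear x Hx. intros x Hx.
replace 0 with (-1 * ln (tan (PI / 2 - x)) - ln (tan x)).
- apply (is_derive_minus (K := R_AbsRing) (V := R_NormedModule));
    [ | apply is_derive_Lam, Hx].
  apply (is_derive_comp Lam (fun x => PI / 2 - x)).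
  + apply is_derive_Lam. lra.
  + auto_derive; [auto | ring].
- assert (Ht : 0 < tan x) by (apply tan_gt_0; lra).
  replace (tan (PI / 2 - x)) with (/ tan x).
  + rewrite ln_Rinv by exact Ht. ring.
  + unfold tan. rewrite sin_shift, cos_shift, Rinv_div. reflexivity.
Qed.

Lemma locally_quadrant (x : R) :
  0 < x < PI / 2 -> locally x (fun y => 0 < y < PI / 2).
Proof.
apply (open_and (fun y => 0 < y) (fun y => y < PI / 2)); [apply open_gt | apply open_lt].
Qed.

(** [Lam] vanishes at 0 and is regular at interior points, which leaves only
    the value of the primitive at the upper bound. *)
Lemma T_eq_Lam (r : R) : 0 < r < 1 / 2 -> T r = Lam (r * PI).
Proof.
intros Hr. assert (HPI := PI_RGT_0).
assert (Hx : 0 < r * PI < PI / 2) by nra.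
assert (HD := locally_quadrant _ Hx).
unfold T. set (Fb := within _ _).
assert (HFb : ProperFilter' Fb).
{ split; [ | apply within_filter, locally_filter].
  unfold Fb, within. intros H. destruct (filter_ex (F := locally (r * PI)) _ (filter_and _ _ H HD)) as [y [Hy Hy']].
  exact (Hy Hy'). }
apply (is_RInt_gen_unique (V := R_CompleteNormedModule)).
assert (HP : filter_prod (at_right 0) Fb (fun ab => forall x,
  Rmin (fst ab) (snd ab) <= x <= Rmax (fst ab) (snd ab) -> 0 < x < PI / 2)).
{ exists (fun a => 0 < a < PI / 2) (fun b => 0 < b < PI / 2).
  - assert (H2 : 0 < PI / 2) by lra.
    exists (mkposreal _ H2). intros y Hy Hy0.
    apply Rabs_def2 in Hy. unfold minus, plus, opp in Hy. simpl in Hy. lra.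
  - unfold Fb, within. apply filter_forall. auto.
  - intros a b Ha Hb x. simpl. unfold Rmin, Rmax. destruct (Rle_dec a b); lra. }
replace (Lam (r * PI)) with (Lam (r * PI) - 0) by ring.
apply (is_RInt_gen_ext (Derive Lam)).
+ revert HP. apply filter_imp. intros ab H x Hab.
  apply is_derive_unique, is_derive_Lam, H. lra.
+ apply is_RInt_gen_Derive.
  * revert HP. apply filter_imp. intros ab H x Hab.
    eexists. apply is_derive_Lam, H, Hab.
  * revert HP. apply filter_imp. intros ab H x Hab. specialize (H x Hab).
    apply (continuous_ext_loc _ (fun t => ln (tan t))).
    -- generalize (locally_quadrant x H). apply filter_imp. intros y Hy. symmetry.
       apply is_derive_unique, is_derive_Lam, Hy.
    -- apply (ex_derive_continuous (fun t => ln (tan t))). eexists.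
       apply (is_derive_comp ln tan).
       ++ apply is_derive_ln, tan_gt_0; lra.
       ++ apply is_derive_tan, Rgt_not_eq, cos_gt_0; lra.
  * exact filterlim_Lam_0.
  * eapply filterlim_filter_le_1; [apply filter_le_within | ].
    apply continuous_Lam, Hx.
Qed.

(** * Real polynomials with as many roots as their degree *)

(** Polynomial functions in Horner form: this presentation makes division by
    [x - a] a plain induction. *)
Fixpoint poly_le (n : nat) (f : R -> R) : Prop :=
  match n with
  | O => exists c, forall x, f x = c
  | S m => exists c g, poly_le m g /\ forall x, f x = c + x * g x
  end.

Lemma poly_le_ext (n : nat) (f g : R -> R) :
  (forall x, g x = f x) -> poly_le n f -> poly_le n g.
Proof.
intros E. destruct n as [ | n]; simpl.
- intros [c Hc]. exists c. intros x. rewrite E. apply Hc.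
- intros [c [h [Hh Hf]]]. exists c, h. split; [exact Hh | ].
  intros x. rewrite E. apply Hf.
Qed.

Lemma poly_le_lin (n : nat) (a b : R) (f g : R -> R) :
  poly_le n f -> poly_le n g -> poly_le n (fun x => a * f x + b * g x).
Proof.
revert f g. induction n as [ | n IH]; simpl; intros f g.
- intros [c Hc] [d Hd]. exists (a * c + b * d). intros x. rewrite Hc, Hd. reflexivity.
- intros [c [f' [Hf Ef]]] [d [g' [Hg Eg]]].
  exists (a * c + b * d), (fun x => a * f' x + b * g' x).
  split; [apply IH; assumption | ].
  intros x. rewrite Ef, Eg. ring.
Qed.

Lemma poly_le_S (n : nat) (f : R -> R) : poly_le n f -> poly_le (S n) f.
Proof.
revert f. induction n as [ | n IH]; intros f.
- intros [c Hc]. exists c, (fun _ => 0). split; [exists 0; reflexivity | ].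
  intros x. rewrite Hc. ring.
- intros [c [g [Hg Ef]]]. exists c, g. split; [apply IH, Hg | exact Ef].
Qed.

Lemma poly_le_mulX (n : nat) (f : R -> R) :
  poly_le n f -> poly_le (S n) (fun x => x * f x).
Proof. intros Hf. exists 0, f. split; [exact Hf | intros x; ring]. Qed.

Lemma poly_le_factor (n : nat) (f : R -> R) (a : R) : poly_le (S n) f ->
  exists q, poly_le n q /\ forall x, f x - f a = (x - a) * q x.
Proof.
revert f. induction n as [ | n IH]; intros f [c [g [Hg Ef]]].
- destruct Hg as [d Hd]. exists (fun _ => d). split; [exists d; reflexivity | ].
  intros x. rewrite !Ef, !Hd. ring.
- destruct (IH g Hg) as [q [Hq Eq]].
  exists (fun x => 1 * g x + a * q x).
  split; [apply poly_le_lin; [exact Hg | apply poly_le_S, Hq] | ].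
  (* [x g(x) - a g(a) = (x - a) g(x) + a (g(x) - g(a))] *)
  intros x. rewrite !Ef.
  transitivity ((x - a) * g x + a * (g x - g a)); [ring | ].
  rewrite Eq. ring.
Qed.

(** The roots are split off one at a time; each quotient keeps the remaining
    roots because they differ from those removed. *)
Lemma poly_le_roots (m : nat) (f : R -> R) (r : nat -> R) :
  poly_le (S m) f ->
  (forall k, (k <= m)%nat -> f (r k) = 0) ->
  (forall i j, (i < j <= m)%nat -> r i <> r j) ->
  exists c, forall x, f x = c * prod_f_R0 (fun k => x - r k) m.
Proof.
revert f. induction m as [ | m IH]; intros f Hf Hr Hd.
- destruct (poly_le_factor _ _ (r 0%nat) Hf) as [q [[c Hc] Eq]].
  exists c. intros x. specialize (Eq x). rewrite Hr, Hc in Eq by lia. simpl. lra.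
- destruct (poly_le_factor _ _ (r (S m)) Hf) as [q [Hq Eq]].
  destruct (IH q Hq) as [c Hc].
  + intros k Hk. assert (H := Eq (r k)). rewrite !Hr in H by lia.
    assert (Hne := Hd k (S m) ltac:(lia)).
    apply (Rmult_eq_reg_l (r k - r (S m))); lra.
  + intros i j Hij. apply Hd. lia.
  + exists c. intros x. specialize (Eq x). rewrite Hr, Hc in Eq by lia. simpl. lra.
Qed.

(** * The multiple-angle product for the tangent *)

(** The polynomial [P] of degree [n] with
    [sin ((2 n + 1) x) = sin x * P (sin x ^ 2)]; the recursion is the addition
    formula [sin ((2 n + 3) x) + sin ((2 n - 1) x) =
    2 cos (2 x) sin ((2 n + 1) x)]. *)
Fixpoint odd_sine_poly (n : nat) (y : R) : R :=
  match n with
  | O => 1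
  | S m =>
    match m with
    | O => 3 - 4 * y
    | S p => (2 - 4 * y) * odd_sine_poly m y - odd_sine_poly p y
    end
  end.

Lemma odd_sine_poly_SS (n : nat) (y : R) :
  odd_sine_poly (S (S n)) y =
  (2 - 4 * y) * odd_sine_poly (S n) y - odd_sine_poly n y.
Proof. reflexivity. Qed.

Lemma poly_le_odd_sine_poly (n : nat) : poly_le n (odd_sine_poly n).
Proof.
enough (H : poly_le n (odd_sine_poly n) /\ poly_le (S n) (odd_sine_poly (S n)))
  by apply H.
induction n as [ | n [IH0 IH1]].
- split.
  + exists 1. reflexivity.
  + exists 3, (fun _ => -4). split; [exists (-4); reflexivity | ].
    intros x. simpl. ring.
- split; [exact IH1 | ].
  apply (poly_le_ext _ (fun y => 1 * (2 * odd_sine_poly (S n) y + (-1) * odd_sine_poly n y)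
    + (-4) * (y * odd_sine_poly (S n) y))).
  + intros y. rewrite odd_sine_poly_SS. ring.
  + apply poly_le_lin; [apply poly_le_lin | apply poly_le_mulX, IH1].
    * apply poly_le_S, IH1.
    * apply poly_le_S, poly_le_S, IH0.
Qed.

Lemma sin_odd_mult (n : nat) (x : R) :
  sin ((2 * INR n + 1) * x) = sin x * odd_sine_poly n (sin x ^ 2).
Proof.
enough (H : sin ((2 * INR n + 1) * x) = sin x * odd_sine_poly n (sin x ^ 2) /\
  sin ((2 * INR (S n) + 1) * x) = sin x * odd_sine_poly (S n) (sin x ^ 2)) by apply H.
assert (Hc : cos (2 * x) = 1 - 2 * sin x ^ 2) by (rewrite cos_2a_sin; ring).
induction n as [ | n [IH0 IH1]].
- split.
  + simpl. rewrite Rmult_0_r, Rplus_0_l, Rmult_1_l. ring.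
  + change (INR 1) with 1. replace ((2 * 1 + 1) * x) with (2 * x + x) by ring.
    rewrite sin_plus, Hc, sin_2a.
    assert (E := sin2_cos2 x). unfold Rsqr in E. simpl.
    replace (2 * sin x * cos x * cos x) with (2 * sin x * (1 - sin x * sin x))
      by (rewrite <- E; ring).
    ring.
- split; [exact IH1 | ].
  rewrite odd_sine_poly_SS.
  replace ((2 * INR (S (S n)) + 1) * x) with ((2 * INR (S n) + 1) * x + 2 * x)
    by (rewrite !S_INR; ring).
  replace ((2 * INR n + 1) * x) with ((2 * INR (S n) + 1) * x - 2 * x) in IH0
    by (rewrite !S_INR; ring).
  rewrite sin_minus, IH1, Hc in IH0. rewrite sin_plus, IH1, Hc. lra.
Qed.

Lemma prod_f_R0_ext (f g : nat -> R) (m : nat) :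
  (forall k, (k <= m)%nat -> f k = g k) -> prod_f_R0 f m = prod_f_R0 g m.
Proof.
induction m as [ | m IH]; intros H; simpl.
- apply H; lia.
- rewrite IH by (intros; apply H; lia). rewrite H by lia. reflexivity.
Qed.

Lemma prod_f_R0_div (f g : nat -> R) (m : nat) :
  prod_f_R0 (fun k => f k / g k) m = prod_f_R0 f m / prod_f_R0 g m.
Proof.
induction m as [ | m IH]; simpl; [reflexivity | ].
rewrite IH. unfold Rdiv. rewrite Rinv_mult. ring.
Qed.

Lemma prod_f_R0_opp (f : nat -> R) (m : nat) :
  prod_f_R0 (fun k => - f k) m = (-1) ^ S m * prod_f_R0 f m.
Proof.
induction m as [ | m IH].
- simpl. ring.
- rewrite <- tech_pow_Rmult. simpl prod_f_R0. rewrite IH. ring.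
Qed.

Lemma ln_prod_f_R0 (f : nat -> R) (m : nat) :
  (forall k, (k <= m)%nat -> 0 < f k) ->
  0 < prod_f_R0 f m /\ ln (prod_f_R0 f m) = sum_n (fun k => ln (f k)) m.
Proof.
induction m as [ | m IH]; intros H.
- rewrite sum_O. split; [apply H; lia | reflexivity].
- destruct IH as [Hp Hl]; [intros; apply H; lia | ].
  assert (Hm := H (S m) ltac:(lia)).
  rewrite sum_Sn. simpl. split.
  + apply Rmult_lt_0_compat; assumption.
  + rewrite ln_mult, Hl by assumption. reflexivity.
Qed.

(** The zeros of [sin ((2 m + 3) x)] inside the quadrant, for [0 <= k <= m].
    The number of zeros is [m + 1] so as to match the number of terms of
    [prod_f_R0 _ m] and [sum_n _ m]. *)
Definition sine_node (m k : nat) : R := INR (S k) * PI / (2 * INR m + 3).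

Lemma sine_node_bounds (m k : nat) : (k <= m)%nat ->
  PI / (2 * INR m + 3) <= sine_node m k <= PI / 2 - PI / (2 * INR m + 3) / 2.
Proof.
intros Hk. assert (HPI := PI_RGT_0). unfold sine_node.
assert (H0 := pos_INR k). apply le_INR in Hk. rewrite S_INR.
assert (Hu : 0 < PI / (2 * INR m + 3)) by (apply Rdiv_lt_0_compat; lra).
replace ((INR k + 1) * PI / (2 * INR m + 3))
  with ((INR k + 1) * (PI / (2 * INR m + 3))) by (field; lra).
replace (PI / 2) with ((INR m + 3 / 2) * (PI / (2 * INR m + 3))) by (field; lra).
nra.
Qed.

(** Both formulas come from the factorization of [odd_sine_poly]: at
    [sin x ^ 2] it gives the sine, and at [cos x ^ 2] (the angle
    [PI / 2 - x]) the cosine.  The unknown leading factor [c] is the same, and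
    cancels in their quotient. *)
Lemma sin_cos_odd_mult_prod (m : nat) : exists c, forall x,
  sin ((2 * INR m + 3) * x) = sin x * (c *
    prod_f_R0 (fun k => sin (sine_node m k + x) * sin (sine_node m k - x)) m) /\
  cos ((2 * INR m + 3) * x) = cos x * (c *
    prod_f_R0 (fun k => cos (sine_node m k + x) * cos (sine_node m k - x)) m).
Proof.
assert (HPI := PI_RGT_0). assert (Hm := pos_INR m).
assert (Hu : 0 < PI / (2 * INR m + 3)) by (apply Rdiv_lt_0_compat; lra).
assert (HN : 2 * INR (S m) + 1 = 2 * INR m + 3) by (rewrite S_INR; ring).
assert (Hs : forall k, (k <= m)%nat -> 0 < sin (sine_node m k)).
{ intros k Hk. assert (B := sine_node_bounds m k Hk). apply sin_gt_0; lra. }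
destruct (poly_le_roots m (odd_sine_poly (S m)) (fun k => sin (sine_node m k) ^ 2))
  as [c Hc].
- apply poly_le_odd_sine_poly.
- intros k Hk. specialize (Hs k Hk).
  assert (E := sin_odd_mult (S m) (sine_node m k)).
  rewrite HN in E.
  replace ((2 * INR m + 3) * sine_node m k) with (INR (S k) * PI) in E
    by (unfold sine_node; field; lra).
  rewrite sin_eq_0_1 in E by (exists (Z.of_nat (S k)); rewrite <- INR_IZR_INZ; reflexivity).
  apply (Rmult_eq_reg_l (sin (sine_node m k))); lra.
- intros i j Hij.
  assert (Bi := sine_node_bounds m i ltac:(lia)).
  assert (Bj := sine_node_bounds m j ltac:(lia)).
  assert (Hlt : sine_node m i < sine_node m j).
  { unfold sine_node. apply Rmult_lt_compat_r; [apply Rinv_0_lt_compat; lra | ].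
    apply Rmult_lt_compat_r; [lra | ]. apply lt_INR. lia. }
  assert (Hsi := Hs i ltac:(lia)).
  assert (Hsij : sin (sine_node m i) < sin (sine_node m j))
    by (apply sin_increasing_1; lra).
  nra.
- exists ((-1) ^ S m * c). intros x. split.
  + rewrite <- HN, sin_odd_mult, Hc.
    rewrite (prod_f_R0_ext _
      (fun k => - (sin (sine_node m k + x) * sin (sine_node m k - x)))).
    * rewrite prod_f_R0_opp. ring.
    * intros k _. rewrite sin_plus, sin_minus.
      assert (E1 := sin2_cos2 x). assert (E2 := sin2_cos2 (sine_node m k)).
      unfold Rsqr in *.
      set (s := sin x) in *. set (t := cos x) in *.
      set (u := sin (sine_node m k)) in *. set (v := cos (sine_node m k)) in *.
      replace (s ^ 2 - u ^ 2) with (s * s * (u * u + v * v) - u * u * (s * s + t * t))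
        by (rewrite E1, E2; ring).
      ring.
  + assert (E := sin_odd_mult (S m) (PI / 2 - x)).
    rewrite HN, sin_shift, Hc in E.
    rewrite (prod_f_R0_ext _
      (fun k => cos (sine_node m k + x) * cos (sine_node m k - x))) in E.
    * replace ((2 * INR m + 3) * (PI / 2 - x)) with
        (PI / 2 - (2 * INR m + 3) * x + INR (S m) * PI) in E
        by (rewrite S_INR; field).
      assert (Esign : forall p y, sin (y + INR p * PI) = (-1) ^ p * sin y).
      { intros p y. induction p as [ | p IH].
        - simpl. rewrite Rmult_0_l, Rplus_0_r. ring.
        - rewrite S_INR, <- tech_pow_Rmult, Rmult_assoc, <- IH.
          replace (y + (INR p + 1) * PI) with (y + INR p * PI + PI) by ring.
          rewrite neg_sin. ring. }
      rewrite Esign, sin_shift in E.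
      assert (Esq : (-1) ^ S m * (-1) ^ S m = 1)
        by (rewrite <- Rpow_mult_distr; replace (-1 * -1) with 1 by ring; apply pow1).
      rewrite <- (Rmult_1_l (cos ((2 * INR m + 3) * x))), <- Esq, Rmult_assoc, E.
      ring.
    * intros k _. rewrite cos_plus, cos_minus.
      assert (E1 := sin2_cos2 x). assert (E2 := sin2_cos2 (sine_node m k)).
      unfold Rsqr in *.
      set (s := sin x) in *. set (t := cos x) in *.
      set (u := sin (sine_node m k)) in *. set (v := cos (sine_node m k)) in *.
      replace (t ^ 2 - u ^ 2) with (t * t * (u * u + v * v) - u * u * (s * s + t * t))
        by (rewrite E1, E2; ring).
      ring.
Qed.

Lemma ln_tan_odd_mult (m : nat) (x : R) :
  0 < x < PI / (2 * INR m + 3) / 2 ->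
  ln (tan ((2 * INR m + 3) * x)) = ln (tan x) +
    sum_n (fun k => ln (tan (sine_node m k + x)) + ln (tan (sine_node m k - x))) m.
Proof.
intros Hx. assert (HPI := PI_RGT_0). assert (Hm := pos_INR m).
assert (Hu : PI / (2 * INR m + 3) <= PI / 3)
  by (apply Rmult_le_compat_l; [lra | apply Rinv_le_contravar; lra]).
assert (HNx : 0 < (2 * INR m + 3) * x < PI / 2).
{ replace (PI / 2) with ((2 * INR m + 3) * (PI / (2 * INR m + 3) / 2)) by (field; lra).
  nra. }
assert (Hpos : forall k, (k <= m)%nat ->
  0 < tan (sine_node m k + x) /\ 0 < tan (sine_node m k - x)).
{ intros k Hk. assert (B := sine_node_bounds m k Hk). split; apply tan_gt_0; lra. }
destruct (ln_prod_f_R0 (fun k => tan (sine_node m k + x) * tan (sine_node m k - x)) m)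
  as [Hp Hl].
{ intros k Hk. apply Rmult_lt_0_compat; apply Hpos, Hk. }
assert (Ht : 0 < tan x) by (apply tan_gt_0; lra).
rewrite (sum_n_ext_loc _ (fun k => ln (tan (sine_node m k + x) * tan (sine_node m k - x)))).
- rewrite <- Hl, <- ln_mult by assumption. f_equal.
  destruct (sin_cos_odd_mult_prod m) as [c Hc]. destruct (Hc x) as [Es Ec].
  assert (Hcos : 0 < cos ((2 * INR m + 3) * x)) by (apply cos_gt_0; lra).
  assert (Hc0 : c <> 0) by (intros ->; rewrite Ec in Hcos; lra).
  unfold tan at 1. rewrite Es, Ec.
  rewrite (prod_f_R0_ext (fun k => tan (sine_node m k + x) * tan (sine_node m k - x))
    (fun k => (sin (sine_node m k + x) * sin (sine_node m k - x)) /
      (cos (sine_node m k + x) * cos (sine_node m k - x)))).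
  + rewrite prod_f_R0_div. unfold tan, Rdiv. rewrite !Rinv_mult.
    transitivity (sin x * / cos x * (c * / c) *
      (prod_f_R0 (fun k => sin (sine_node m k + x) * sin (sine_node m k - x)) m *
      / prod_f_R0 (fun k => cos (sine_node m k + x) * cos (sine_node m k - x)) m)); [ring | ].
    rewrite Rinv_r by exact Hc0. ring.
  + intros k _. unfold tan, Rdiv. rewrite Rinv_mult. ring.
- intros k Hk. rewrite ln_mult by (apply Hpos, Hk). reflexivity.
Qed.

(** * Integrating the product formula *)

Lemma filterlim_sum_n_0 {S : Type} (F : (S -> Prop) -> Prop) {FF : Filter F}
    (f : nat -> S -> R) (m : nat) :
  (forall k, (k <= m)%nat -> filterlim (f k) F (locally 0)) ->
  filterlim (fun x => sum_n (fun k => f k x) m) F (locally 0).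
Proof.
induction m as [ | m IH]; intros H.
- apply (filterlim_ext (f 0%nat)); [intros x; rewrite sum_O; reflexivity | ].
  apply H. lia.
- apply (filterlim_ext (fun x => sum_n (fun k => f k x) m + f (Datatypes.S m) x)).
  { intros x. rewrite sum_Sn. reflexivity. }
  replace (locally 0) with (locally (0 + 0)) by (f_equal; ring).
  eapply filterlim_comp_2; [apply IH; intros; apply H; lia | apply H; lia | ].
  apply (filterlim_plus (V := R_NormedModule)).
Qed.

(** Both sides tend to 0 at 0 and have the same derivative by
    [ln_tan_odd_mult]. *)
Lemma Lam_odd_mult (m : nat) (x : R) :
  0 < x < PI / (2 * INR m + 3) / 2 ->
  Lam ((2 * INR m + 3) * x) / (2 * INR m + 3) = Lam x +
    sum_n (fun k => Lam (sine_node m k + x) - Lam (sine_node m k - x)) m.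
Proof.
revert x. assert (HPI := PI_RGT_0). assert (Hm := pos_INR m).
set (N := 2 * INR m + 3) in *.
assert (HN : 3 <= N) by (unfold N; lra).
assert (Hu : 0 < PI / N) by (apply Rdiv_lt_0_compat; lra).
assert (Hu3 : PI / N <= PI / 3)
  by (apply Rmult_le_compat_l; [lra | apply Rinv_le_contravar; lra]).
assert (Hnode : forall k, (k <= m)%nat -> PI / N <= sine_node m k <= PI / 2 - PI / N / 2)
  by apply sine_node_bounds.
set (h x := / N * Lam (N * x) - Lam x -
  sum_n (fun k => Lam (sine_node m k + x) - Lam (sine_node m k - x)) m).
enough (H : forall x, 0 < x < PI / N / 2 -> h x = 0).
{ intros x Hx. specialize (H x Hx). unfold h in H. unfold Rdiv at 1. lra. }
apply derive_zero_right_lim_0.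
- intros x Hx.
  assert (HNx : 0 < N * x < PI / 2).
  { replace (PI / 2) with (N * (PI / N / 2)) by (field; lra). nra. }
  assert (E := ln_tan_odd_mult m x Hx). fold N in E.
  replace 0 with (/ N * (N * ln (tan (N * x))) - ln (tan x) -
    sum_n (fun k => ln (tan (sine_node m k + x)) + ln (tan (sine_node m k - x))) m)
    by (rewrite E; field; lra).
  apply (is_derive_minus (K := R_AbsRing) (V := R_NormedModule));
    [apply (is_derive_minus (K := R_AbsRing) (V := R_NormedModule)) | ].
  + apply (is_derive_scal (fun x => Lam (N * x))).
    apply (is_derive_comp Lam (fun x => N * x)).
    * apply is_derive_Lam, HNx.
    * auto_derive; [auto | ring].
  + apply is_derive_Lam. lra.
  + apply (is_derive_sum_n (K := R_AbsRing) (V := R_NormedModule)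
      (fun k x => Lam (sine_node m k + x) - Lam (sine_node m k - x))).
    intros k Hk. specialize (Hnode k Hk).
    replace (ln (tan (sine_node m k + x)) + ln (tan (sine_node m k - x)))
      with (1 * ln (tan (sine_node m k + x)) - (-1) * ln (tan (sine_node m k - x))) by ring.
    apply (is_derive_minus (K := R_AbsRing) (V := R_NormedModule)).
    * apply (is_derive_comp Lam (fun x => sine_node m k + x)).
      -- apply is_derive_Lam. lra.
      -- auto_derive; [auto | ring].
    * apply (is_derive_comp Lam (fun x => sine_node m k - x)).
      -- apply is_derive_Lam. lra.
      -- auto_derive; [auto | ring].
- replace (locally 0) with (locally (/ N * 0 - 0 - 0)) by (f_equal; ring).
  apply (filterlim_Rminus (at_right 0)); [apply (filterlim_Rminus (at_right 0)) | ].
  + apply (filterlim_comp _ _ _ (fun x => Lam (N * x)) (fun y => / N * y)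
      (at_right 0) (locally 0)).
    * apply (filterlim_comp _ _ _ (fun x => N * x) Lam (at_right 0) (at_right 0));
        [ | exact filterlim_Lam_0].
      intros P [e He].
      assert (He' : 0 < e / N) by (apply Rdiv_lt_0_compat; [apply e | lra]).
      exists (mkposreal _ He'). intros y Hy Hy0.
      apply Rabs_def2 in Hy. unfold minus, plus, opp in Hy. simpl in Hy.
      assert (Hy1 : N * y < e).
      { replace (pos e) with (N * (e / N)) by (field; lra). nra. }
      apply He; [ | nra].
      apply Rabs_def1; unfold minus, plus, opp; simpl; [lra | ].
      assert (0 < N * y) by nra. assert (0 < e) by apply e. lra.
    * apply (filterlim_scal_r (K := R_AbsRing) (V := R_NormedModule) (/ N) 0).
  + exact filterlim_Lam_0.
  + apply (filterlim_sum_n_0 (at_right 0)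
      (fun k x => Lam (sine_node m k + x) - Lam (sine_node m k - x))).
    intros k Hk. specialize (Hnode k Hk).
    replace (locally 0) with
      (locally (Lam (sine_node m k + 0) - Lam (sine_node m k - 0)))
      by (rewrite Rplus_0_r, Rminus_0_r; f_equal; ring).
    eapply filterlim_filter_le_1; [apply filter_le_within | ].
    apply (filterlim_Rminus (locally 0)).
    * apply (continuous_comp (fun x => sine_node m k + x) Lam).
      -- apply (ex_derive_continuous (fun x => sine_node m k + x)). auto_derive; auto.
      -- apply continuous_Lam. lra.
    * apply (continuous_comp (fun x => sine_node m k - x) Lam).
      -- apply (ex_derive_continuous (fun x => sine_node m k - x)). auto_derive; auto.
      -- apply continuous_Lam. lra.
Qed.

(** * Folding the alternating sum *)

(** The shape in which the terms of [Lam_odd_mult] come: an odd number of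
    them, the first one alone and the others in pairs. *)
Lemma sum_n_pairs (g : nat -> R) (m : nat) :
  g 1%nat + sum_n (fun k => g (2 * k + 2)%nat + g (2 * k + 3)%nat) m =
  sum_n_m g 1 (2 * m + 3).
Proof.
induction m as [ | m IH].
- rewrite sum_O. change (2 * 0 + 3)%nat with 3%nat.
  rewrite 2!sum_n_Sm, sum_n_n by lia. unfold plus. simpl. ring.
- rewrite sum_Sn. replace (2 * S m + 3)%nat with (S (S (2 * m + 3))) by lia.
  rewrite 2!sum_n_Sm, <- IH by lia.
  replace (2 * S m + 2)%nat with (S (2 * m + 3)) by lia.
  replace (2 * S m + 3)%nat with (S (S (2 * m + 3))) by lia.
  unfold plus. simpl. ring.
Qed.

(** Centred on the middle index: passing from [n] to [n + 1] adds the two end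
    terms, provided that the rest is re-indexed, hence the induction for all
    [g]. *)
Lemma sum_n_m_fold (g : nat -> R) (n : nat) :
  sum_n_m g 1 (2 * n + 1) =
  g (n + 1)%nat + sum_n_m (fun j => g j + g (2 * n + 2 - j)%nat) 1 n.
Proof.
revert g. induction n as [ | n IH]; intros g.
- rewrite sum_n_n, sum_n_m_zero by lia. symmetry. apply Rplus_0_r.
- replace (2 * S n + 1)%nat with (S (S (2 * n + 1))) by lia.
  rewrite sum_n_Sm, sum_Sn_m by lia.
  rewrite <- (sum_n_m_S g), IH.
  rewrite (sum_Sn_m _ 1 (S n)) by lia.
  rewrite <- (sum_n_m_S (fun j => g j + g (2 * S n + 2 - j)%nat)).
  rewrite (sum_n_m_ext_loc (fun j => g (S j) + g (S (2 * n + 2 - j)))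
    (fun j => g (S j) + g (2 * S n + 2 - S j)%nat)).
  + replace (2 * S n + 2 - 1)%nat with (S (S (2 * n + 1))) by lia.
    replace (S n + 1)%nat with (S (n + 1)) by lia.
    unfold plus. simpl. ring.
  + intros k Hk. do 2 f_equal. lia.
Qed.

Theorem theorem6 (n : nat) (hn : (0 < n)%nat) (heven : Nat.Even n) :
  Catalan = - T (1 / 4) /\
  - T (1 / 4) =
    (2 * INR n + 1) / INR n *
    sum_n_m (fun j : nat =>
      (-1) ^ (j + 1) * T ((2 * INR j - 1) / (8 * INR n + 4))) 1 n.
Proof.
assert (HPI := PI_RGT_0).
assert (HT : T (1 / 4) = Lam (PI / 4)).
{ rewrite T_eq_Lam by lra. f_equal. field. }
split; [rewrite HT, Lam_PI4; ring | ].
rewrite HT.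
destruct n as [ | m]; [lia | ]. set (n := S m) in *.
assert (Hn : 1 <= INR n) by (apply (le_INR 1); lia).
assert (HnS : INR n = INR m + 1) by apply S_INR.
set (g j := (-1) ^ (j + 1) * Lam ((2 * INR j - 1) * PI / (4 * (2 * INR n + 1)))).
rewrite (sum_n_m_ext_loc _ g).
2: { intros j Hj. unfold g. f_equal.
  assert (H1 : 1 <= INR j) by (apply (le_INR 1); lia).
  assert (H2 : INR j <= INR n) by (apply le_INR; lia).
  rewrite T_eq_Lam.
  - f_equal. field. lra.
  - split.
    + apply Rdiv_lt_0_compat; lra.
    + apply Rlt_div_l; lra. }
assert (Hsign : forall k, (-1) ^ (2 * k) = 1).
{ intros k. rewrite pow_mult. replace ((-1) ^ 2) with 1 by ring. apply pow1. }
(* At this [x], the angles [x], [a_k - x] and [a_k + x] are the odd multiples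
   of [PI / (4 N)]: [4 k - 1] and [4 k + 1] for [a_k = k PI / N]. *)
assert (Hx : 0 < PI / (4 * (2 * INR n + 1)) < PI / (2 * INR m + 3) / 2).
{ assert (Hu : 0 < PI / (2 * INR m + 3)) by (apply Rdiv_lt_0_compat; lra).
  rewrite HnS.
  replace (PI / (4 * (2 * (INR m + 1) + 1))) with (PI / (2 * INR m + 3) / 4) by (field; lra).
  lra. }
assert (Hmult := Lam_odd_mult m _ Hx).
replace ((2 * INR m + 3) * (PI / (4 * (2 * INR n + 1)))) with (PI / 4) in Hmult
  by (rewrite HnS; field; lra).
assert (Hsum : Lam (PI / 4) / (2 * INR m + 3) = sum_n_m g 1 (2 * n + 1)).
{ replace (2 * n + 1)%nat with (2 * m + 3)%nat by lia.
  rewrite <- sum_n_pairs, Hmult. f_equal.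
  - unfold g. change (INR 1) with 1. simpl pow.
    replace ((2 * 1 - 1) * PI) with PI by ring. ring.
  - apply sum_n_ext. intros k. unfold g, sine_node.
    match goal with |- ?a = ?b => change (a = b :> R) end.
    replace (2 * k + 2 + 1)%nat with (2 * (k + 1) + 1)%nat by lia.
    replace (2 * k + 3 + 1)%nat with (2 * (k + 2))%nat by lia.
    rewrite pow_add, !Hsign, pow_1.
    rewrite !plus_INR, !mult_INR, S_INR, HnS.
    change (INR 2) with 2. replace (INR 3) with 3 by (simpl; ring).
    replace ((2 * (2 * INR k + 2) - 1) * PI / (4 * (2 * (INR m + 1) + 1))) with
      ((INR k + 1) * PI / (2 * INR m + 3) - PI / (4 * (2 * (INR m + 1) + 1)))
      by (field; assert (Hm := pos_INR m); lra).
    replace ((2 * (2 * INR k + 3) - 1) * PI / (4 * (2 * (INR m + 1) + 1))) with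
      ((INR k + 1) * PI / (2 * INR m + 3) + PI / (4 * (2 * (INR m + 1) + 1)))
      by (field; assert (Hm := pos_INR m); lra).
    ring. }
rewrite sum_n_m_fold in Hsum.
rewrite (sum_n_m_ext_loc _ (fun j => mult 2 (g j))) in Hsum.
(* [j] and [2 n + 2 - j] give complementary angles and equal signs. *)
2: { intros j Hj. enough (E : g (2 * n + 2 - j)%nat = g j).
  { rewrite E. change (g j + g j = 2 * g j :> R). ring. }
  assert (H1 : 1 <= INR j) by (apply (le_INR 1); lia).
  assert (H2 : INR j <= INR n) by (apply le_INR; lia).
  unfold g. rewrite minus_INR, plus_INR, mult_INR by lia. change (INR 2) with 2.
  replace (2 * n + 2 - j + 1)%nat with (2 * (n + 1 - j) + (j + 1))%nat by lia.
  rewrite pow_add, Hsign, Rmult_1_l. f_equal.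
  rewrite <- Lam_reflect.
  - f_equal. field. lra.
  - assert (0 < PI / (4 * (2 * INR n + 1))) by lra.
    replace (PI / 2) with ((4 * INR n + 2) * (PI / (4 * (2 * INR n + 1)))) by (field; lra).
    replace ((2 * INR j - 1) * PI / (4 * (2 * INR n + 1)))
      with ((2 * INR j - 1) * (PI / (4 * (2 * INR n + 1)))) by (field; lra).
    nra. }
rewrite (sum_n_m_mult_l (K := R_Ring)) in Hsum.
assert (Hmid : g (n + 1)%nat = Lam (PI / 4)).
{ unfold g. destruct heven as [p Hp].
  replace (n + 1 + 1)%nat with (2 * (p + 1))%nat by lia.
  rewrite Hsign, Rmult_1_l, plus_INR. change (INR 1) with 1.
  f_equal. field. lra. }
rewrite Hmid in Hsum.
set (s := sum_n_m g 1 n) in *.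
change (Lam (PI / 4) / (2 * INR m + 3) = Lam (PI / 4) + 2 * s) in Hsum.
replace (2 * INR m + 3) with (2 * INR n + 1) in Hsum by lra.
assert (Hs : s = (Lam (PI / 4) / (2 * INR n + 1) - Lam (PI / 4)) / 2) by lra.
rewrite Hs. field. lra.
Qed.
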